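(* Let $X$ be a finite abstract simplicial complex. There is a unique function $L: M(X) \to \mathbb{R}$ satisfying the following two axioms: (1) (Valuation axiom) For every subdivision $X'$ of $X$, every simplicial map $f: X' \to X$, and all subcomplexes $A, B$ of $X'$: $L(f,\emptyset) = 0$ and \[ L(f, A\cup B) = L(f,A) + L(f,B) - L(f, A\cap B). \] (2) (Simplex axiom) For every subdivision $X'$ of $X$, every simplicial map $f: X'\to X$, and every simplex $x$ of $X'$: \[ L(f,x) = (-1)^{\dim x} c(f,x) + L(f,\partial x). \]
   Context: Let $S$ be a finite set with power set $P(S)$. A simplicial complex (or complex) is a subset $C \subset P(S)$ such that $x\in C$ and $y \subseteq x$ imply $y\in C$; only nonempty sets are counted as simplices. A complex with exactly one maximal element $a$ is called a simplex and denoted $\bar a$ (the set of all nonempty subsets of $a$); its dimension is $|a|-1$. The boundary of a simplex $\bar a$ is the complex $\partial \bar a = \bar a - \{a\}$; so the boundary of a vertex is $\emptyset$. A simplex $x$ of a complex is regarded also as the subcomplex consisting of $x$ and its faces. Subdivisions are the usual subdivisions of simplicial complexes (the geometric realizations of a complex and of its subdivision are identified). $M(X)$ is the set of all pairs $(f,A)$ where $f: X' \to X$ is a simplicial map for some subdivision $X'$ of $X$ and $A$ is a subcomplex of $X'$. Definition of $c(f,x)$. Let $C_q$ denote oriented simplicial $q$-chains. Let $(f,A)\in M(X)$ with $A$ a subcomplex of the subdivision $X'$, let $f_q: C_q(A)\to C_q(X)$ be the induced map on chains, let $j_A: C_q(X')\to C_q(A)$ be the linear map that is the identity on $q$-simplices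 of $A$ and zero on $q$-simplices not in $A$, and let $s_A: C_q(X)\to C_q(X')$ be the linear map sending a $q$-simplex $x$ of $X$ to the sum, with coefficient $1$, of all $q$-simplices of $X'$ contained in $x$ (arising from subdividing $x$), these being oriented compatibly with $x$. Put $f_{A,q} = s_A\circ f_q\circ j_A: C_q(X')\to C_q(X')$. For a $q$-simplex $x$ of $A$, $c(f,x)$ is the coefficient on $x$ in the chain $f_{A,q}(x)$ (for $x$ a simplex of $X'$, one may take any subcomplex $A$ containing $x$; the value does not depend on this choice). Thus $c(f,x)\in\{-1,0,1\}$: it is the orientation $\pm 1$ with which $x$ covers itself when $x$ arises as part of the subdivision of the $q$-simplex $f(x)$, and $0$ otherwise. *)

(* Defs.v *)
From mathcomp Require Import boolp classical_sets reals.
From mathcomp Require Import all_boot all_order all_algebra finmap.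

Set Implicit Arguments.
Unset Strict Implicit.
Unset Printing Implicit Defensive.

Import Order.TTheory GRing.Theory Num.Theory.
Local Open Scope ring_scope.

Section Complexes.
Variable T : finType.
Implicit Types (C A B : {set {set T}}) (x y : {set T}).

(* The empty set is never counted as a simplex. *)
Definition is_complex C : bool :=
  (set0 \notin C) &&
  [forall x in C, forall y : {set T},
     (y != set0) && (y \subset x) ==> (y \in C)].

Record subcomplex C := Subcomplex {
  subcomplex_set :> {set {set T}};
  subcomplexP : is_complex subcomplex_set && (subcomplex_set \subset C) }.

Definition simplex (q : nat) C := {x : {set T} | (x \in C) && (#|x| == q.+1)}.

Definition closed_simplex x : {set {set T}} :=
  [set y : {set T} | (y != set0) && (y \subset x)]%SET.

Definition boundary x : {set {set T}} := closed_simplex x :\ x.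

Lemma is_complexP C :
  reflect (set0 \notin C /\
           forall x y, x \in C -> y != set0 -> y \subset x -> y \in C)
          (is_complex C).
Proof.
apply: (iffP andP) => -[C0 CS]; split=> //.
  by move=> x y xC y0 yx; move/forall_inP/(_ x xC)/forallP/(_ y): CS; rewrite y0 yx.
apply/forall_inP => x xC; apply/forallP => y; apply/implyP => /andP[y0 yx].
exact: CS xC y0 yx.
Qed.

Lemma empty_subproof C :
  is_complex (set0 : {set {set T}}) && ((set0 : {set {set T}}) \subset C).
Proof. by rewrite sub0set andbT; apply/is_complexP; split=> [|x y]; rewrite inE. Qed.

Lemma union_subproof C (A B : subcomplex C) :
  is_complex (A :|: B)%SET && ((A :|: B)%SET \subset C).
Proof.
case: A B => [A /andP[/is_complexP[A0 AS] AC]] [B /andP[/is_complexP[B0 BS] BC]] /=.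
rewrite subUset AC BC !andbT; apply/is_complexP; split=> [|x y].
  by rewrite inE negb_or A0.
by rewrite !inE => /orP[xA|xB] y0 yx;
  [rewrite (AS x y xA)|rewrite (BS x y xB) ?orbT].
Qed.

Lemma inter_subproof C (A B : subcomplex C) :
  is_complex (A :&: B)%SET && ((A :&: B)%SET \subset C).
Proof.
case: A B => [A /andP[/is_complexP[A0 AS] AC]] [B /andP[/is_complexP[B0 BS] BC]] /=.
apply/andP; split; last exact: fintype.subset_trans (subsetIl _ _) AC.
apply/is_complexP; split=> [|x y]; first by rewrite inE negb_and A0.
by rewrite !inE => /andP[xA xB] y0 yx; rewrite (AS x y xA) // (BS x y xB).
Qed.

Lemma closed_simplex_subproof q C (hC : is_complex C) (x : simplex q C) :
  is_complex (closed_simplex (val x)) && (closed_simplex (val x) \subset C).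
Proof.
case/is_complexP: hC => C0 CS; case: x => x /= /andP[xC _]; apply/andP; split.
  apply/is_complexP; split=> [|y z]; first by rewrite inE eqxx.
  by rewrite !inE => /andP[_ yx] -> /= zy; apply: fintype.subset_trans zy yx.
by apply/fintype.subsetP => y; rewrite inE => /andP[y0 yx]; apply: CS yx.
Qed.

Lemma boundary_subproof q C (hC : is_complex C) (x : simplex q C) :
  is_complex (boundary (val x)) && (boundary (val x) \subset C).
Proof.
case/andP: (closed_simplex_subproof hC x) => /is_complexP[_ xS] xC.
apply/andP; split; last exact: fintype.subset_trans (subD1set _ _) xC.
apply/is_complexP; split=> [|y z]; first by rewrite !inE eqxx andbF.
rewrite !inE => /andP[yx /andP[_ syx]] z0 zy.
rewrite z0 (fintype.subset_trans zy syx) /= andbT.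
by apply: contraNneq yx => zx; rewrite finset.eqEsubset syx /=; move: zy; rewrite zx.
Qed.

Definition sc_empty C : subcomplex C := Subcomplex (empty_subproof C).
Definition sc_union C (A B : subcomplex C) := Subcomplex (union_subproof A B).
Definition sc_inter C (A B : subcomplex C) := Subcomplex (inter_subproof A B).
Definition sc_simplex q C (hC : is_complex C) (x : simplex q C) :=
  Subcomplex (closed_simplex_subproof hC x).
Definition sc_boundary q C (hC : is_complex C) (x : simplex q C) :=
  Subcomplex (boundary_subproof hC x).

End Complexes.

Section Chains.
Variable T : finType.
Implicit Types (C : {set {set T}}).

Lemma simplex_card q C (x : simplex q C) : q.+1 = #|val x|.
Proof. by case: x => x /= /andP[_ /eqP]. Qed.

(* Every simplex is given the orientation [vtx x 0, ..., vtx x q]; *)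
(* with these orientations the q-simplices are a basis of the group of *)
(* oriented q-chains. The coefficient self_coef below does not depend on *)
(* these choices: reordering a simplex changes two signs that cancel. *)
Definition vtx q C (x : simplex q C) (i : 'I_q.+1) : T :=
  enum_val (cast_ord (simplex_card x) i).

Definition chain (q : nat) C := {ffun simplex q C -> int}.

Definition linear_ext q C (V : zmodType) (phi : simplex q C -> V)
    (c : chain q C) : V := \sum_x phi x *~ c x.

(* The basis element x of the q-chains of C, or 0 if x is not in C. *)
Definition elementary q C (x : {set T}) : chain q C :=
  [ffun y => (val y == x)%:R].

(* The oriented simplex [t 0, ..., t q]: the determinant is the sign of the *)
(* permutation from t to the chosen order of y if t enumerates y, and it is *)
(* 0 if t has a repetition or leaves y. *)
Definition oriented q C (t : 'I_q.+1 -> T) : chain q C :=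
  [ffun y => \det (\matrix_(i, j) (t i == vtx y j)%:R : 'M[int]_q.+1)].

Definition chain_restr q C (A : {set {set T}}) : chain q C -> chain q A :=
  linear_ext (fun x : simplex q C => elementary q A (val x)).

End Chains.

Definition chain_map (T S : finType) (f : T -> S) q
    (A : {set {set T}}) (X : {set {set S}}) : chain q A -> chain q X :=
  linear_ext (fun x : simplex q A => oriented X (f \o vtx x)).

Section Geometry.
Variables (R : realType) (S : finType).
Implicit Types (X : {set {set S}}).

(* Points of the realization of a complex on S, as functions of the vertices *)
(* (barycentric coordinates). *)
Definition point := {ffun S -> R}.

Definition cell (x : {set S}) : classical_sets.set point :=
  [set p : point | [/\ forall s, 0 <= p s, \sum_s p s = 1
                     & forall s, p s != 0 -> s \in x]]%classic.

Section Hull.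
Variable P : {fset point}.

Definition hull (y : {set P}) : classical_sets.set point :=
  [set p : point | exists w : P -> R,
     [/\ forall v, v \in y -> 0 <= w v, \sum_(v in y) w v = 1
       & forall s, p s = \sum_(v in y) w v * val v s]]%classic.

Definition affinely_independent (y : {set P}) : Prop :=
  forall w : P -> R, \sum_(v in y) w v = 0 ->
    (forall s, \sum_(v in y) w v * val v s = 0) ->
  forall v, v \in y -> w v = 0.

End Hull.

(* The realizations of X and X' are identified, so the vertices of X' are *)
(* points of the realization of X and X' is a geometric complex with the same *)
(* underlying space, each simplex of which lies in a simplex of X. *)
Record subdivision X := Subdivision {
  sd_points : {fset point};
  sd_complex : {set {set sd_points}};
  sd_is_complex : is_complex sd_complex;
  sd_vertex : forall v, [set v]%SET \in sd_complex;
  sd_affine : forall y, y \in sd_complex -> affinely_independent y;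
  sd_meet : forall y z, y \in sd_complex -> z \in sd_complex ->
    (hull y `&` hull z)%classic = hull (y :&: z)%SET;
  sd_carrier : forall y, y \in sd_complex ->
    exists2 x, x \in X & (hull y `<=` cell x)%classic;
  sd_cover : (\bigcup_(y in [set y | y \in sd_complex]) hull y =
              \bigcup_(x in [set x | x \in X]) cell x)%classic }.

Record simplicial_map X (X' : subdivision X) := SimplicialMap {
  sm_fun :> {ffun sd_points X' -> S};
  sm_simplicial : forall y, y \in sd_complex X' -> [set sm_fun v | v in y]%SET \in X }.

Record M X := MPair {
  M_sd : subdivision X;
  M_map : simplicial_map M_sd;
  M_sub : subcomplex (sd_complex M_sd) }.

Section SelfCover.
Variables (X : {set {set S}}) (X' : subdivision X).

(* For q-simplices y of X' contained in x, the matrix expresses the vertices *)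
(* of y in barycentric coordinates on x; y is oriented compatibly with x iff *)
(* its determinant is positive, and then y enters with coefficient 1. *)
Definition chain_subdiv q : chain q X -> chain q (sd_complex X') :=
  linear_ext (fun x : simplex q X => [ffun y : simplex q (sd_complex X') =>
    if `[< (hull (val y) `<=` cell (val x))%classic >]
    then sgz (\det (\matrix_(i, j) val (vtx y i) (vtx x j))) else 0]).

Definition chain_self (f : simplicial_map X') (A : {set {set sd_points X'}}) q :
    chain q (sd_complex X') -> chain q (sd_complex X') :=
  @chain_subdiv q \o @chain_map _ _ f q A X \o @chain_restr _ q (sd_complex X') A.

(* A is taken to be all of X'; see self_coef_indep. *)
Definition self_coef (f : simplicial_map X') q
    (x : simplex q (sd_complex X')) : int :=
  chain_self f (sd_complex X') (elementary q _ (val x)) x.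

Lemma self_coef_indep (f : simplicial_map X') q (x : simplex q (sd_complex X'))
    (A : {set {set sd_points X'}}) :
  val x \in A -> chain_self f A (elementary q _ (val x)) x = self_coef f x.
Proof.
have restr (B : {set {set sd_points X'}}) :
    @chain_restr _ q (sd_complex X') B (elementary q _ (val x)) =
    elementary q B (val x).
  rewrite /chain_restr /linear_ext (bigD1 x) //= big1 => [|y yx].
    by rewrite !ffunE eqxx addr0.
  by rewrite ffunE (inj_eq val_inj) (negbTE yx).
have push (B : {set {set sd_points X'}}) (xB : val x \in B) :
    @chain_map _ _ f q B X (elementary q B (val x)) = oriented X (f \o vtx x).
  have hx : (val x \in B) && (#|val x| == q.+1) by rewrite xB -simplex_card eqxx.
  pose x' : simplex q B :=
    exist (fun y : {set sd_points X'} => (y \in B) && (#|y| == q.+1)) (val x) hx.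
  rewrite /chain_map /linear_ext (bigD1 x') //= big1 => [|y yx]; last first.
    by rewrite ffunE -[val x]/(val x') (inj_eq val_inj) (negbTE yx).
  rewrite ffunE eqxx addr0; congr oriented; apply: funext => i /=.
  rewrite /vtx; congr (f (enum_val _)); exact: val_inj.
by move=> xA; rewrite /self_coef /chain_self /= !restr !push //; case/andP: (valP x).
Qed.

End SelfCover.

Definition valuation_axiom X (L : M X -> R) : Prop :=
  forall (X' : subdivision X) (f : simplicial_map X'),
    L (MPair f (sc_empty (sd_complex X'))) = 0 /\
    forall A B : subcomplex (sd_complex X'),
      L (MPair f (sc_union A B)) =
      L (MPair f A) + L (MPair f B) - L (MPair f (sc_inter A B)).

Definition simplex_axiom X (L : M X -> R) : Prop :=
  forall (X' : subdivision X) (f : simplicial_map X') (q : nat)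
         (x : simplex q (sd_complex X')),
    L (MPair f (sc_simplex (sd_is_complex X') x)) =
    (-1) ^+ q * (self_coef f x)%:~R
    + L (MPair f (sc_boundary (sd_is_complex X') x)).

End Geometry.

(* Main.v *)
Require Import Defs.
From mathcomp Require Import boolp classical_sets reals.
From mathcomp Require Import all_boot all_order all_algebra finmap.

(** Fix a map f and put w x = (-1)^(dim x) c(f,x).  Both axioms only relate
    the values L(f,A) for this one f, and they say that adjoining a simplex x
    to a subcomplex that already contains its boundary adds w x:  if x is a
    maximal simplex of A, then A is the union of A minus x and of the closed
    simplex x, which meet in the boundary of x, so that
      L(f,A) = L(f,A - x) + L(f,x) - L(f,bd x) = L(f,A - x) + w x.
    Uniqueness follows by removing maximal simplices one at a time
    ([valuation_unique]).  Existence holds because the sum of w over the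
    simplices of A, which is the alternating sum of the traces of f_{A,q},
    satisfies both axioms ([weight_sum_valuation], [weight_sum_simplex]).
    Both steps are carried out for weights in any abelian group on the
    simplices of an abstract complex. *)

Set Implicit Arguments.
Unset Strict Implicit.
Unset Printing Implicit Defensive.

Import GRing.Theory.
Local Open Scope ring_scope.

Section WeightedValuations.
Variables (T : finType) (C : {set {set T}}) (hC : is_complex C).
Variables (V : zmodType) (w : forall q, simplex q C -> V).
Implicit Types (A B : subcomplex C) (g : subcomplex C -> V).

Definition is_valuation g : Prop :=
  g (sc_empty C) = 0 /\
  forall A B, g (sc_union A B) = g A + g B - g (sc_inter A B).

Definition has_simplex_weights g : Prop :=
  forall q (x : simplex q C),
    g (sc_simplex hC x) = w x + g (sc_boundary hC x).

Lemma subcomplex_eq A B : subcomplex_set A = subcomplex_set B -> A = B.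
Proof.
case: A B => [A hA] [B hB] /= eqAB; case: B / eqAB hB => hB.
by rewrite (bool_irrelevance hA hB).
Qed.

Lemma remove_maximal_subproof A (x : {set T}) :
    (forall y, y \in subcomplex_set A -> x \subset y -> y = x) ->
  is_complex (subcomplex_set A :\ x) && (subcomplex_set A :\ x \subset C).
Proof.
case: A => A /= /andP[/is_complexP[A0 AS] AC] xmax; apply/andP; split; last first.
  exact: fintype.subset_trans (subD1set _ _) AC.
apply/is_complexP; split=> [|y z]; first by rewrite !inE (negbTE A0) andbF.
rewrite !inE => /andP[yx yA] z0 zy; rewrite (AS y z yA z0 zy) andbT.
by apply: contraNneq yx => zx; apply/eqP/xmax; rewrite // -zx.
Qed.

(** The two axioms together determine the effect of removing a maximal
    simplex, and every subcomplex is exhausted by such removals. *)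
Lemma valuation_unique g1 g2 :
    is_valuation g1 -> has_simplex_weights g1 ->
    is_valuation g2 -> has_simplex_weights g2 ->
  forall A, g1 A = g2 A.
Proof.
move=> [g1_0 g1U] g1w [g2_0 g2U] g2w A.
have [n] := ubnP #|subcomplex_set A|; elim: n A => // n IHn A ltAn.
have [A0|[a aA]] := set_0Vmem (subcomplex_set A).
  by rewrite (_ : A = sc_empty C) ?g1_0 ?g2_0 //; apply: subcomplex_eq.
case: (arg_maxnP (fun y : {set T} => #|y|) aA) => x memAx x_card.
have {memAx} xA : x \in subcomplex_set A := memAx.
have xmax y : y \in subcomplex_set A -> x \subset y -> y = x.
  by move=> yA xy; apply/esym/eqP; rewrite finset.eqEcard xy; apply: x_card.
pose A' := Subcomplex (remove_maximal_subproof xmax).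
have /andP[/is_complexP[An0 AS] /fintype.subsetP AC] := subcomplexP A.
have x0 : x != finset.set0 by apply: contraNneq An0 => <-.
have hx : (x \in C) && (#|x| == #|x|.-1.+1).
  by rewrite (AC x xA) (@prednK #|x|) ?eqxx ?finset.card_gt0.
pose sx : simplex #|x|.-1 C :=
  exist (fun y : {set T} => (y \in C) && (#|y| == #|x|.-1.+1)) x hx.
have defA : A = sc_union A' (sc_simplex hC sx).
  apply: subcomplex_eq; apply/setP => y; rewrite !inE /=.
  have [->|_] := eqVneq y x; first by rewrite x0 xA subxx.
  have [//|yA /=] := boolP (y \in subcomplex_set A); apply/esym/negbTE.
  by apply: contra yA => /andP[y0 yx]; apply: AS yx.
have defI : sc_inter A' (sc_simplex hC sx) = sc_boundary hC sx.
  apply: subcomplex_eq; apply/setP => y; rewrite !inE /= -andbA; congr (_ && _).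
  by apply: andb_idl => /andP[y0 yx]; apply: AS yx.
rewrite defA g1U g2U defI g1w g2w !addrA !addrK; congr (_ + _); apply: IHn.
by move: ltAn; rewrite (cardsD1 x) xA ltnS.
Qed.

(** The bound #|T| on q is harmless: a q-simplex has q + 1 vertices in T. *)
Definition weight_sum A : V :=
  \sum_(q < #|T|) \sum_(x : simplex q C | val x \in subcomplex_set A) w x.

Lemma weight_sum_valuation : is_valuation weight_sum.
Proof.
split=> [|A B]; first by apply: big1 => q _; apply: big1 => x; rewrite inE.
rewrite /weight_sum -big_split -sumrB; apply: eq_bigr => q _ /=.
rewrite !(big_mkcond (fun x : simplex q C => val x \in _)) -big_split -sumrB.
apply: eq_bigr => x _ /=; rewrite !inE.
by do 2![case: (_ \in _)]; rewrite /= ?addrK ?subr0 ?addr0 ?add0r.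
Qed.

Lemma weight_sum_simplex : has_simplex_weights weight_sum.
Proof.
move=> q x; have /andP[xC /eqP x_card] := valP x.
have x_closed : val x \in closed_simplex (val x).
  by rewrite inE subxx -card_gt0 x_card.
have ltq : (q < #|T|)%N by rewrite -x_card max_card.
rewrite /weight_sum (bigD1 (Ordinal ltq)) //= [in RHS](bigD1 (Ordinal ltq)) //=.
rewrite (bigD1 x) //= -addrA; congr (_ + (_ + _)).
  by apply: eq_bigl => y; rewrite -(inj_eq val_inj) finset.in_setD1 andbC.
apply: eq_bigr => p; rewrite -(inj_eq val_inj) /= => neq_pq; apply: eq_bigl => y.
rewrite finset.in_setD1 (_ : val y != val x) //.
apply: contraNneq neq_pq => eq_yx.
by rewrite -eqSS (simplex_card y) (simplex_card x) eq_yx.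
Qed.

End WeightedValuations.

Theorem theorem3 (R : realType) (S : finType) (X : {set {set S}})
    (hX : is_complex X) :
  exists! L : M R X -> R, valuation_axiom L /\ simplex_axiom L.
Proof.
pose w (X' : subdivision R X) (f : simplicial_map X') q
  (x : simplex q (sd_complex X')) : R := (-1) ^+ q * (self_coef f x)%:~R.
exists (fun m => weight_sum (w _ (M_map m)) (M_sub m)); split.
  split=> [X' f|X' f q x]; first exact: (weight_sum_valuation (w X' f)).
  exact: (weight_sum_simplex (sd_is_complex X') (w X' f)).
move=> L [Lval Lsimp]; apply: funext => -[X' f A] /=.
have [wval wsimp] := (weight_sum_valuation (w X' f),
  weight_sum_simplex (sd_is_complex X') (w X' f)).
exact: (valuation_unique wval wsimp (g2 := fun B => L (MPair f B))
  (Lval X' f) (Lsimp X' f)).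
Qed.
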